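(* For $n\ge 0$ let $B_n(t)=\sum_{\pi\in B_n}t^{\operatorname{des}_B(\pi)}$ be the type B Eulerian polynomial (with $B_0(t)=1$), and let \[P_n(t)=\sum_{k=0}^{n-1}B_k(t)\binom{n}{k}(t-1)^{n-k-1}.\] Then for every $n\ge 1$, \[B_n(t)=P_n(t)+t^nP_n(t^{-1}).\]
   Context: $B_n$ denotes the group of signed permutations: bijections $\pi$ of the integers $[-n,n]$ with $\pi(-i)=-\pi(i)$ for all $i$ (so $\pi(0)=0$), written in window notation $[\pi(1),\dots,\pi(n)]$. The type B descent set is $\operatorname{Des}_B(\pi)=\{i\in\{0,1,\dots,n-1\}:\pi(i)>\pi(i+1)\}$ (using $\pi(0)=0$), and $\operatorname{des}_B(\pi)=|\operatorname{Des}_B(\pi)|$. *)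

(* Defs.v *)
From HB Require Import structures.
From mathcomp Require Import all_boot all_order all_fingroup all_algebra.

Set Implicit Arguments.
Unset Strict Implicit.
Unset Printing Implicit Defensive.

Import Order.TTheory GRing.Theory Num.Theory.
Local Open Scope ring_scope.

(* The integer interval [-n, n] is encoded as 'I_(n.*2.+1): the ordinal i     *)
(* stands for the integer i - n.                                              *)
Notation sym_interval n := 'I_(n.*2.+1).

Definition to_int (n : nat) (i : sym_interval n) : int := i%:Z - n%:Z.

Definition of_nat (n k : nat) : sym_interval n := inord (n + k).

(* Meaningful for k <= n only, where to_int (of_nat n k) = k. *)
Definition window (n : nat) (pi : {perm (sym_interval n)}) (k : nat) : int :=
  to_int (pi (of_nat n k)).

Definition signed_perms (n : nat) : {set {perm (sym_interval n)}} :=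
  [set pi : {perm (sym_interval n)} |
    [forall i, forall j,
      (to_int j == - to_int i) ==> (to_int (pi j) == - to_int (pi i))]].

Definition DesB (n : nat) (pi : {perm (sym_interval n)}) : {set 'I_n} :=
  [set i : 'I_n | window pi i > window pi i.+1].

Definition desB (n : nat) (pi : {perm (sym_interval n)}) : nat := #|DesB pi|.

Definition eulerianB (n : nat) : {poly int} :=
  \sum_(pi in signed_perms n) 'X^(desB pi).

Definition Ppoly (n : nat) : {poly int} :=
  \sum_(k < n) eulerianB k * 'C(n, k)%:R * ('X - 1) ^+ (n - k - 1).

Definition subst (p : {poly int}) (x : {fraction {poly int}}) :
    {fraction {poly int}} :=
  (map_poly intr p).[x].

(* Main.v *)
(* Inserting n+1 or -(n+1) at every place of the window of a signed permutation
   gives B_(n+1) = (1 + (2n+1)t) B_n + 2t(1-t) B_n'.  Consequently, for c = +1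
   and c = -1, the sums S_c(n) = sum_k C(n,k) B_k (c(1-t))^(n-k) satisfy
   S_c(n+1) = (1 + t + 2nt + c(1-t)) S_c(n) + 2t(1-t) S_c(n)', whence
   S_(-1)(n) = t S_1(n) for n >= 1.  Negating all values shows t^n B_n(1/t) = B_n,
   so t^n P_n(1/t) = t sum_(k<n) C(n,k) B_k (1-t)^(n-k-1), and separating the terms
   k = n of S_(-1) and t S_1 yields the claim multiplied by t-1. *)

Require Import Defs.
From HB Require Import structures.
From mathcomp Require Import all_boot all_order all_fingroup all_algebra.
From mathcomp Require Import ring zify.

Import Order.TTheory GRing.Theory Num.Theory.
Local Open Scope ring_scope.

(** * Signed permutations as words, generated by insertion *)

Fixpoint insertions {T : Type} (e : T) (w : seq T) : seq (seq T) :=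
  if w is b :: w' then (e :: w) :: map (cons b) (insertions e w')
  else [:: [:: e]].

Fixpoint signed_words (n : nat) : seq (seq int) :=
  if n is m.+1 then
    [seq v | w <- signed_words m,
             v <- insertions m.+1%:Z w ++ insertions (- m.+1%:Z) w]
  else [:: [::]].

(** The parameter [a] is the value just before the word; [a = 0] stands for pi(0), so a negative
    first letter counts as a descent. *)
Fixpoint des_from (a : int) (w : seq int) : nat :=
  if w is b :: w' then ((b < a)%R + des_from b w')%N else 0%N.

Lemma mem_insertions (T : eqType) (e : T) (w v : seq T) :
  reflect (exists s1 s2, w = s1 ++ s2 /\ v = s1 ++ e :: s2)
          (v \in insertions e w).
Proof.
apply: (iffP idP).
  elim: w v => [|b w IH] v /=.
    by rewrite inE => /eqP ->; exists [::], [::].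
  rewrite inE => /orP[/eqP ->|/mapP[u /IH[s1 [s2 [-> ->]]] ->]].
    by exists [::], (b :: w).
  by exists (b :: s1), s2.
case=> s1 [s2 [-> ->]]; elim: s1 => [|b s1 IH] /=.
  by case: s2 => [|c s2] /=; rewrite inE eqxx.
by rewrite inE map_f ?orbT.
Qed.

Lemma uniq_insertions (T : eqType) (e : T) (w : seq T) :
  e \notin w -> uniq (insertions e w).
Proof.
elim: w => [|b w IH] //=; rewrite inE negb_or => /andP[eb /IH uw].
rewrite map_inj_uniq ?uw ?andbT; last by move=> x y [].
by apply/mapP => -[u _ [ebE _]]; rewrite ebE eqxx in eb.
Qed.

Definition is_signed_word (n : nat) (w : seq int) : bool :=
  perm_eq (map absz w) (iota 1 n).

Lemma signed_word_absz (n : nat) (w : seq int) :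
  is_signed_word n w -> {in w, forall x, (0 < `|x| <= n)%N}.
Proof.
move=> /perm_mem wn x xw; have := wn `|x|%N.
by rewrite map_f // mem_iota add1n => /esym.
Qed.

Lemma is_signed_word_insertion (n : nat) (e : int) (s1 s2 : seq int) :
  `|e|%N = n.+1 ->
  is_signed_word n.+1 (s1 ++ e :: s2) = is_signed_word n (s1 ++ s2).
Proof.
move=> en.
have iotaS : iota 1 n.+1 = iota 1 n ++ [:: n.+1]
  by rewrite -(iotaD 1 n 1) addn1.
rewrite /is_signed_word iotaS.
rewrite !map_cat /= en -cat1s perm_catCA perm_sym perm_catC perm_cat2l.
by rewrite perm_sym.
Qed.

Lemma mem_signed_words (n : nat) (w : seq int) :
  (w \in signed_words n) = is_signed_word n w.
Proof.
elim: n w => [|n IH] w.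
  rewrite inE /is_signed_word; case: w => //= a w.
  by apply/esym/negP=> /perm_size.
apply/allpairsPdep/idP.
  case=> u [v [+ + ->]]; rewrite IH mem_cat => uW.
  by case/orP => /mem_insertions[s1 [s2 [uE ->]]];
    rewrite is_signed_word_insertion -?uE ?abszN.
move=> wW.
have /mapP[e ew en] : n.+1 \in map absz w.
  by rewrite (perm_mem wW) mem_iota; lia.
case/splitPr: ew wW => s1 s2; rewrite is_signed_word_insertion // => sW.
exists (s1 ++ s2), (s1 ++ e :: s2); rewrite IH sW; split=> //.
rewrite mem_cat.
have [eE|eE] : e = n.+1%:Z \/ e = - n.+1%:Z by lia.
  by apply/orP; left; apply/mem_insertions; exists s1, s2; rewrite -eE.
by apply/orP; right; apply/mem_insertions; exists s1, s2; rewrite -eE.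
Qed.

Lemma uniq_signed_words (n : nat) : uniq (signed_words n).
Proof.
elim: n => [|n IH] //.
have small w : w \in signed_words n -> {in w, forall x : int, (`|x| <= n)%N}.
  by rewrite mem_signed_words => /signed_word_absz wn x /wn /andP[].
(* Deleting the only letter of absolute value n+1 undoes the insertion, so no word arises from two
   shorter ones. *)
have recover w v : w \in signed_words n ->
    v \in insertions n.+1%:Z w ++ insertions (- n.+1%:Z) w ->
    w = [seq x <- v | (`|x| <= n)%N].
  move=> /small wn; rewrite mem_cat.
  by case/orP => /mem_insertions[s1 [s2 [wE ->]]]; 
    rewrite filter_cat /= ?abszN ltnn -filter_cat -wE; apply/esym/all_filterP/allP.
apply: allpairs_uniq_dep => //.
  move=> w wW; rewrite cat_uniq !uniq_insertions ?andbT.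
  - apply/hasPn => v /mem_insertions[s1 [s2 [wE ->]]].
    apply/negP => /mem_insertions[r1 [r2 [wE2 E]]].
    have : - n.+1%:Z \in r1 ++ n.+1%:Z :: r2 by rewrite -E mem_cat mem_head orbT.
    rewrite mem_cat inE orbCA -mem_cat -wE2 => /orP[/eqP|/(small _ wW)]; lia.
  - by apply/negP => /(small _ wW); lia.
  - by apply/negP => /(small _ wW); lia.
move=> [w v] [w' v'] /allpairsPdep[x [y [xW yI [-> ->]]]].
move=> /allpairsPdep[x' [y' [xW' yI' [-> ->]]]] /= yy.
subst y'.
by rewrite (recover _ _ xW yI) (recover _ _ xW' yI').
Qed.

(** * Descents after inserting an extreme letter, and the recurrence for B_n *)

(** A maximal letter placed in a gap makes an ascent, then a descent: a descent gap keeps the count,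
    an ascent gap raises it by one. At the end it adds no descent, whence the 1. *)
Lemma sum_insertions_max (M a : int) (w : seq int) :
  {in a :: w, forall x, x < M} ->
  \sum_(v <- insertions M w) 'X^(des_from a v) =
    'X^(des_from a w) * (1 + (des_from a w)%:R
      + ((size w)%:R - (des_from a w)%:R) * 'X) :> {poly int}.
Proof.
elim: w a => [|b w IH] a awM.
  by rewrite big_seq1 /= lt_gtF ?awM ?mem_head // expr0; ring.
have aM : a < M by rewrite awM ?mem_head.
have bM : b < M by rewrite awM // !inE eqxx orbT.
rewrite big_cons big_map /= bM lt_gtF // add0n.
under eq_bigr do rewrite exprD.
rewrite -big_distrr IH /=; last by move=> x xw; rewrite awM // inE xw orbT.
by case: (b < a); rewrite ?add0n ?add1n exprS -!natr1; ring.
Qed.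

(** The gaps behave as for a maximal letter, but a minimal letter at the end creates a descent,
    whence ['X] in place of 1. *)
Lemma sum_insertions_min (M a : int) (w : seq int) :
  {in a :: w, forall x, M < x} ->
  \sum_(v <- insertions M w) 'X^(des_from a v) =
    'X^(des_from a w) * ('X + (des_from a w)%:R
      + ((size w)%:R - (des_from a w)%:R) * 'X) :> {poly int}.
Proof.
elim: w a => [|b w IH] a awM.
  by rewrite big_seq1 /= awM ?mem_head // expr0; ring.
have aM : M < a by rewrite awM ?mem_head.
have bM : M < b by rewrite awM // !inE eqxx orbT.
rewrite big_cons big_map /= (lt_gtF bM) aM add0n.
under eq_bigr do rewrite exprD.
rewrite -big_distrr IH /=; last by move=> x xw; rewrite awM // inE xw orbT.
by case: (b < a); rewrite ?add0n ?add1n exprS -!natr1; ring.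
Qed.

Lemma mulX_derivXn (R : comNzRingType) (d : nat) :
  'X * ('X^d)^`() = d%:R * 'X^d :> {poly R}.
Proof.
by rewrite derivXn; case: d => [|d]; rewrite ?mulr0n ?mulr0 ?mul0r //
  mulrnAr -exprS mulr_natl.
Qed.

Lemma sum_signed_wordsS (n : nat) (B := fun m : nat =>
    \sum_(w <- signed_words m) 'X^(des_from 0 w) : {poly int}) :
  B n.+1 = (1 + (n.*2.+1)%:R * 'X) * B n + 2 * 'X * (1 - 'X) * (B n)^`().
Proof.
rewrite /B big_allpairs_dep /= raddf_sum !big_distrr -big_split /=.
apply: eq_big_seq => w; rewrite mem_signed_words => wn.
have szw : size w = n by rewrite -(size_map absz) (perm_size wn) size_iota.
have bound : {in 0 :: w, forall x : int, (`|x| <= n)%N}.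
  move=> x; rewrite inE => /orP[/eqP ->|/(signed_word_absz _ _ wn)/andP[]] //.
rewrite big_cat sum_insertions_max ?sum_insertions_min /=; first last.
- by move=> x /bound; lia.
- by move=> x /bound; lia.
(* With d descents the two insertion factors add up to 1 + (2n+1)X + 2d(1-X); the factor d is
   produced by X times the derivative of X^d. *)
have -> : 2 * 'X * (1 - 'X) * ('X^(des_from 0 w))^`() =
    2 * (1 - 'X) * ('X * ('X^(des_from 0 w))^`()) :> {poly int} by ring.
rewrite mulX_derivXn szw -addnn -natr1 natrD; ring.
Qed.

(** * Bijection between signed permutations and words *)

Definition signed_word_of {n : nat} (pi : {perm (sym_interval n)}) : seq int :=
  mkseq (fun k => window pi k.+1) n.

Lemma to_int_inj (n : nat) : injective (@to_int n).
Proof. by move=> i j /addIr[/ord_inj]. Qed.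

Lemma to_int_of_nat (n k : nat) : (k <= n)%N -> to_int (of_nat n k) = k.
Proof. by move=> kn; rewrite /to_int inordK; lia. Qed.

Lemma to_int_bound (n : nat) (i : sym_interval n) : (`|to_int i| <= n)%N.
Proof. by rewrite /to_int; have := ltn_ord i; lia. Qed.

Definition of_int (n : nat) (z : int) : sym_interval n := inord `|z + n%:Z|.

Lemma of_intK (n : nat) (z : int) : (`|z| <= n)%N -> to_int (of_int n z) = z.
Proof. by move=> zn; rewrite /to_int inordK; lia. Qed.

Lemma signed_permsP (n : nat) (pi : {perm (sym_interval n)}) :
  reflect (forall i j, to_int j = - to_int i ->
             to_int (pi j) = - to_int (pi i))
          (pi \in signed_perms n).
Proof.
rewrite inE; apply: (iffP 'forall_'forall_implyP) => pP i j.
  by move=> /eqP /pP /eqP.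
by move=> /eqP /pP ->.
Qed.

(** Oddness makes the window determine the permutation; sign 0 covers the fixed point 0. *)
Lemma signed_perm_sgz_window (n : nat) (pi : {perm (sym_interval n)})
    (i : sym_interval n) :
  pi \in signed_perms n ->
  to_int (pi i) = sgz (to_int i) * window pi `|to_int i|.
Proof.
move=> /signed_permsP piP; have bi := to_int_bound n i.
have [i0|i0|i0] := sgzP (to_int i).
- rewrite mul0r; have := piP i i; rewrite i0 oppr0 => /(_ erefl); lia.
- rewrite mul1r /window; congr (to_int (pi _)).
  by apply: to_int_inj; rewrite to_int_of_nat; lia.
- rewrite mulN1r /window; apply: piP.
  by rewrite to_int_of_nat //; lia.
Qed.

Lemma window_nth (n : nat) (pi : {perm (sym_interval n)}) (k : nat) :
  pi \in signed_perms n -> (k <= n)%N ->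
  window pi k = nth 0 (0 :: signed_word_of pi) k.
Proof.
move=> piP; case: k => [|k] kn /=; last by rewrite nth_mkseq.
by rewrite /window signed_perm_sgz_window // to_int_of_nat // mul0r.
Qed.

Lemma signed_word_of_inj (n : nat) :
  {in signed_perms n &, injective (@signed_word_of n)}.
Proof.
move=> p q pP qP E; apply/permP => i; apply: to_int_inj.
by rewrite !signed_perm_sgz_window // !window_nth ?E ?to_int_bound.
Qed.

Lemma absz_window_inj (n : nat) (pi : {perm (sym_interval n)}) (k l : nat) :
  pi \in signed_perms n -> (k <= n)%N -> (l <= n)%N ->
  `|window pi k|%N = `|window pi l|%N -> k = l.
Proof.
move=> /signed_permsP piP kn ln kl.
have [E|E] : window pi k = window pi l \/ window pi k = - window pi l by lia.
  move/to_int_inj/perm_inj/(congr1 (@to_int n)): E.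
  by rewrite !to_int_of_nat // => -[].
(* In the case pi(k) = -pi(l) = pi(-l), injectivity gives k = -l, so both are 0. *)
have lN : to_int (of_int n (- l%:Z)) = - to_int (of_nat n l).
  by rewrite of_intK ?to_int_of_nat //; lia.
move: E; rewrite -(piP _ _ lN) => /to_int_inj/perm_inj/(congr1 (@to_int n)).
by rewrite lN !to_int_of_nat //; lia.
Qed.

Lemma signed_word_ofP (n : nat) (pi : {perm (sym_interval n)}) :
  pi \in signed_perms n -> is_signed_word n (signed_word_of pi).
Proof.
move=> piP; rewrite /is_signed_word; set s := map _ _.
have ss : size s = n by rewrite size_map size_mkseq.
have us : uniq s.
  rewrite /s /mkseq -map_comp map_inj_in_uniq ?iota_uniq // => k l.
  by rewrite !mem_iota /= => kn ln /(absz_window_inj _ _ _ _ piP kn ln)[].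
have sub : {subset s <= iota 1 n}.
  move=> x /mapP[y /mapP[k]]; rewrite !mem_iota /= => kn -> ->.
  have := to_int_bound _ (pi (of_nat n k.+1)); rewrite -/(window pi k.+1).
  (* A zero in the window would repeat the value pi(0) = 0 at a positive position. *)
  case: (posnP `|window pi k.+1|) => [E|]; last by lia.
  have w0 : window pi 0 = 0 by rewrite window_nth.
  by move: E; rewrite -[0%N]/(absz 0) -w0 =>
    /(absz_window_inj _ _ _ 0 piP kn (leq0n n)).
have [|_ mem_s] := uniq_min_size us sub; first by rewrite ss size_iota.
by apply: uniq_perm => //; exact: iota_uniq.
Qed.

Lemma signed_word_of_surj (n : nat) (w : seq int) :
  is_signed_word n w ->
  exists2 pi, pi \in signed_perms n & signed_word_of pi = w.
Proof.
move=> wn; have szw : size w = n.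
  by rewrite -(size_map absz) (perm_size wn) size_iota.
have uw : uniq (map absz w) by rewrite (perm_uniq wn) iota_uniq.
(* The odd extension of the word to all integers in [-n, n]; the predecessor appears because window
   positions start at 1 and list indices at 0. *)
pose g (z : int) : int := sgz z * nth 0 w `|z|.-1.
have nth_bound (z : int) : z != 0 -> (`|z| <= n)%N ->
    (0 < `|nth 0%R w `|z|.-1| <= n)%N.
  by move=> z0 zn; apply: (signed_word_absz _ _ wn); apply: mem_nth;
    rewrite szw; lia.
have g_neq0 (z : int) : z != 0 -> (`|z| <= n)%N -> (0 < `|g z| <= n)%N.
  by move=> z0 zn; have := nth_bound z z0 zn; rewrite /g; case: sgzP z0; lia.
have g0 : g 0 = 0 by rewrite /g sgz0 mul0r.
have gN (z : int) : g (- z) = - g z by rewrite /g sgzN mulNr abszN.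
have g_bound (z : int) : (`|z| <= n)%N -> (`|g z| <= n)%N.
  by have [->|z0 /(g_neq0 _ z0)/andP[]] := eqVneq z 0; rewrite ?g0.
have absz_g (z : int) : z != 0 -> `|g z|%N = `|nth 0%R w `|z|.-1|%N.
  by move=> z0; rewrite /g; case: sgzP z0; lia.
have nth_inj (z t : int) : z != 0 -> t != 0 -> (`|z| <= n)%N -> (`|t| <= n)%N ->
    `|g z|%N = `|g t|%N -> `|z|%N = `|t|%N.
  move=> z0 t0 zn tn; rewrite !absz_g // -!(nth_map 0 0%N) ?szw; [|lia|lia].
  by move/eqP; rewrite nth_uniq ?size_map ?szw //; lia.
have g_inj (z t : int) : (`|z| <= n)%N -> (`|t| <= n)%N -> g z = g t -> z = t.
  move=> zn tn gzt.
  have [z0|z0] := eqVneq z 0.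
    have [->//|/g_neq0/(_ tn)] := eqVneq t 0.
    by rewrite -gzt z0 g0.
  have [t0|t0] := eqVneq t 0.
    by have := g_neq0 z z0 zn; rewrite gzt t0 g0.
  have zt : `|z|%N = `|t|%N by apply: nth_inj; rewrite ?gzt.
  have [//|tN] : z = t \/ z = - t by lia.
  by have := g_neq0 t t0 tn; move: gzt; rewrite tN gN; lia.
pose f (i : sym_interval n) := of_int n (g (to_int i)).
have fE i : to_int (f i) = g (to_int i).
  by rewrite of_intK // g_bound ?to_int_bound.
have f_inj : injective f.
  move=> i j /(congr1 (@to_int n)); rewrite !fE => /g_inj ij.
  by apply: to_int_inj; apply: ij; exact: to_int_bound.
exists (perm f_inj).
  by apply/signed_permsP => i j ij; rewrite !permE !fE ij gN.
apply: (@eq_from_nth _ 0) => [|k]; rewrite size_mkseq ?szw // => kn.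
by rewrite nth_mkseq // /window permE fE to_int_of_nat // /g mul1r.
Qed.

Lemma perm_signed_words (n : nat) :
  perm_eq [seq signed_word_of pi | pi <- enum (signed_perms n)]
          (signed_words n).
Proof.
apply: uniq_perm; last 1 first.
- move=> w; rewrite mem_signed_words; apply/mapP/idP.
    by case=> pi; rewrite mem_enum => piP ->; exact: signed_word_ofP.
  by case/signed_word_of_surj => pi piP <-; exists pi; rewrite ?mem_enum.
- rewrite map_inj_in_uniq ?enum_uniq // => p q.
  by rewrite !mem_enum; exact: signed_word_of_inj.
- exact: uniq_signed_words.
Qed.

Lemma des_from_sum (a : int) (w : seq int) :
  des_from a w = (\sum_(i < size w) (nth 0 w i < nth 0 (a :: w) i)%R)%N.
Proof.
elim: w a => [|b w IH] a /=; first by rewrite big_ord0.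
by rewrite big_ord_recl IH.
Qed.

Lemma desB_word (n : nat) (pi : {perm (sym_interval n)}) :
  pi \in signed_perms n -> desB pi = des_from 0 (signed_word_of pi).
Proof.
move=> piP; rewrite /desB -sum1dep_card big_mkcond des_from_sum size_mkseq.
by apply: eq_bigr => i _; rewrite !window_nth ?(ltnW (ltn_ord i)).
Qed.

Lemma eulerianB_words (n : nat) :
  eulerianB n = \sum_(w <- signed_words n) 'X^(des_from 0 w).
Proof.
rewrite -(perm_big _ (perm_signed_words n)) big_map big_enum.
by apply: eq_bigr => pi /desB_word ->.
Qed.

Lemma eulerianB0 : eulerianB 0 = 1.
Proof. by rewrite eulerianB_words big_seq1. Qed.

Lemma eulerianBS (n : nat) :
  eulerianB n.+1 = (1 + (n.*2.+1)%:R * 'X) * eulerianB n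
                   + 2 * 'X * (1 - 'X) * (eulerianB n)^`().
Proof. by rewrite !eulerianB_words sum_signed_wordsS. Qed.

(** * Binomial transforms of the polynomials B_k *)

(** Here [c] is the whole base of the powers: S_1 and S_(-1) are the values at [1 - 'X] and
    ['X - 1]. *)
Definition binomial_transform (c : {poly int}) (n : nat) : {poly int} :=
  \sum_(k < n.+1) eulerianB k * 'C(n, k)%:R * c ^+ (n - k).

Lemma binomial_transform0 (c : {poly int}) : binomial_transform c 0 = 1.
Proof. by rewrite /binomial_transform big_ord1 eulerianB0 bin0 expr0 !mulr1. Qed.

(** In Pascal's rule, the C(n,k+1) terms join the k = 0 term to form the multiple of [c]; the C(n,k)
    terms give the sum with shifted B. *)
Lemma binomial_transform_pascal (c : {poly int}) (n : nat) :
  binomial_transform c n.+1 = c * binomial_transform c n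
    + \sum_(k < n.+1) eulerianB k.+1 * 'C(n, k)%:R * c ^+ (n - k).
Proof.
rewrite /binomial_transform big_ord_recl /= !bin0 !subn0.
under eq_bigr => i _ do
  rewrite /bump leq0n add1n binS natrD mulrDr mulrDl subSS.
rewrite big_split /= addrA; congr (_ + _).
rewrite big_ord_recr /= bin_small // mulr0 mul0r addr0.
rewrite big_ord_recl /= bin0 subn0 mulrDr exprS; congr (_ + _); first by ring.
rewrite big_distrr; apply: eq_bigr => i _ /=.
rewrite /bump leq0n add1n -[in LHS](subnSK (ltn_ord i)) exprS; ring.
Qed.

Lemma binomial_transformS (a : int) (c : {poly int}) (n : nat) :
  c = a *: (1 - 'X) ->
  binomial_transform c n.+1 = (1 + 'X + n.*2%:R * 'X + c) * binomial_transform c n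
    + 2 * 'X * (1 - 'X) * (binomial_transform c n)^`().
Proof.
move=> cE; have c' : (1 - 'X) * c^`() = - c.
  by rewrite cE derivZ derivB derivX derivC sub0r scalerN mulrN -scalerAr mulr1.
rewrite binomial_transform_pascal /binomial_transform.
rewrite raddf_sum !big_distrr -!big_split /=; apply: eq_bigr => k _.
rewrite eulerianBS (mulrS 1 k.*2) -!mul2n !natrM.
(* Since [c] is a scalar multiple of 1-X, differentiating its powers only brings out the exponent;
   with m = n-k this turns 2nX into the 2kX of the recurrence for B_k. *)
have cX m : (1 - 'X) * (c ^+ m)^`() = - (m%:R * c ^+ m).
  rewrite deriv_exp; case: m => [|m]; first by rewrite mulr0n mulr0 mul0r oppr0.
  rewrite -mulr_natl mulrCA [_ * (c^`() * _)]mulrA c' exprS /=; ring.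
have kn : (k <= n)%N by rewrite -ltnS.
have -> : n%:R = k%:R + (n - k)%:R :> {poly int} by rewrite -natrD subnKC.
rewrite !derivM -polyC_natr derivC; move: (cX (n - k)%N); set e := (n - k)%N => cXe.
have -> : forall B B' C D D' : {poly int},
  2 * 'X * (1 - 'X) * ((B' * C + B * 0) * D + B * C * D')
  = 2 * 'X * B * C * ((1 - 'X) * D') + 2 * 'X * (1 - 'X) * B' * C * D.
  by move=> *; ring.
by rewrite cXe; ring.
Qed.

(* Dividing by (1 - X) ^+ n.+1, both sides become the power series
   sum_j (2 j)^n X^j; here this is replaced by a common recurrence. *)
Lemma binomial_transform_sym (n : nat) : (0 < n)%N ->
  binomial_transform ('X - 1) n = 'X * binomial_transform (1 - 'X) n.
Proof.
have SN m := @binomial_transformS (-1) ('X - 1) m.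
have SP m := @binomial_transformS 1 (1 - 'X) m.
(* The induction starts at 1, where both sides are 2X; at 0 the equation would read 1 = X. *)
case: n => // n _; elim: n => [|n IH].
  by rewrite SN ?SP ?binomial_transform0 ?scale1r ?scaleN1r ?opprB //
    derivC double0 mulr0n; ring.
(* Differentiating the factor ['X] adds 2X(1-X) S_1, exactly the gap between the summands X-1 and
   1-X of the two recurrences. *)
rewrite SN ?scaleN1r ?opprB // SP ?scale1r // IH derivM derivX.
rewrite -!mul2n !natrM -natr1; ring.
Qed.

(** * Negation and palindromicity of B_n *)

Definition negate {n : nat} (pi : {perm (sym_interval n)}) :
  {perm (sym_interval n)} := (pi * perm rev_ord_inj)%g.

Lemma to_int_rev_ord (n : nat) (i : sym_interval n) :
  to_int (rev_ord i) = - to_int i.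
Proof. by rewrite /to_int /=; have := ltn_ord i; lia. Qed.

Lemma to_int_negate (n : nat) (pi : {perm (sym_interval n)}) i :
  to_int (negate pi i) = - to_int (pi i).
Proof. by rewrite permM permE to_int_rev_ord. Qed.

Lemma negateK (n : nat) : involutive (@negate n).
Proof.
by move=> pi; apply/permP => i; apply: to_int_inj; rewrite !to_int_negate opprK.
Qed.

Lemma negate_signed (n : nat) (pi : {perm (sym_interval n)}) :
  (negate pi \in signed_perms n) = (pi \in signed_perms n).
Proof.
have sub p : p \in signed_perms n -> negate p \in signed_perms n.
  move=> /signed_permsP pP; apply/signed_permsP => i j ij.
  by rewrite !to_int_negate (pP _ _ ij).
by apply/idP/idP => [/sub|/sub//]; rewrite negateK.
Qed.

Lemma desB_negate (n : nat) (pi : {perm (sym_interval n)}) :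
  desB (negate pi) = (n - desB pi)%N.
Proof.
rewrite /desB; have -> : DesB (negate pi) = ~: DesB pi.
  apply/setP => i; rewrite !inE /window !to_int_negate ltrN2 -leNgt lt_neqAle.
  (* Neighbouring values are distinct by injectivity, so every non-descent is a strict ascent. *)
  rewrite andb_idl // => _; apply/eqP => /to_int_inj/perm_inj/(congr1 (@to_int n)).
  by rewrite !to_int_of_nat ?(ltnW (ltn_ord i)) // => -[]; lia.
by rewrite cardsCs setCK card_ord.
Qed.

Lemma desB_le (n : nat) (pi : {perm (sym_interval n)}) : (desB pi <= n)%N.
Proof. by rewrite -[leqRHS]card_ord max_card. Qed.

(** Substitution of 1/X written as a composite of ring morphisms, so that it commutes with sums,
    products and powers. *)
Definition invX_eval : {poly int} -> {fraction {poly int}} :=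
  horner_eval (tofrac 'X)^-1 \o map_poly intr.

HB.instance Definition _ := GRing.RMorphism.on invX_eval.

Lemma tofracX_neq0 : tofrac ('X : {poly int}) != 0.
Proof. by rewrite tofrac_eq0 polyX_eq0. Qed.

Lemma invX_evalX : invX_eval 'X = (tofrac 'X)^-1.
Proof. by rewrite /invX_eval /= map_polyX /horner_eval hornerX. Qed.

Lemma eulerianB_palindromic (n : nat) :
  tofrac 'X ^+ n * invX_eval (eulerianB n) = tofrac (eulerianB n).
Proof.
rewrite /eulerianB [in RHS](reindex_inj (inv_inj (@negateK n))) /=.
rewrite (eq_bigl _ _ (@negate_signed n)) !rmorph_sum big_distrr /=.
apply: eq_bigr => pi _; rewrite desB_negate !rmorphXn /= invX_evalX exprVn.
by rewrite expfB_cond ?(negPf tofracX_neq0) ?desB_le.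
Qed.

(** * The reciprocal of P_n and the final identity *)

Lemma Ppoly_reciprocal (n : nat) :
  tofrac 'X ^+ n * invX_eval (Ppoly n) =
  tofrac ('X * \sum_(k < n) eulerianB k * 'C(n, k)%:R * (1 - 'X) ^+ (n - k - 1)).
Proof.
rewrite /Ppoly !rmorphM !rmorph_sum !big_distrr; apply: eq_bigr => k _ /=.
(* X^k reverses B_k, X^(n-k-1) turns the powers of 1/X - 1 into powers of 1 - X, and one factor X is
   left over. *)
have nE : n = (1 + k + (n - k - 1))%N by have := ltn_ord k; lia.
rewrite {1}nE !rmorphM !rmorphXn !rmorphB !rmorph_nat !rmorph1 /=.
rewrite -eulerianB_palindromic invX_evalX !exprD expr1.
have -> : 1 - tofrac 'X = tofrac 'X * ((tofrac 'X)^-1 - 1) :> {fraction {poly int}}.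
  by rewrite mulrBr mulfV ?tofracX_neq0 ?mulr1.
by rewrite exprMn; ring.
Qed.

Lemma binomial_transform_top (c : {poly int}) (n : nat) :
  binomial_transform c n = eulerianB n +
    c * \sum_(k < n) eulerianB k * 'C(n, k)%:R * c ^+ (n - k - 1).
Proof.
rewrite /binomial_transform big_ord_recr /= binn subnn expr0 !mulr1 addrC.
congr (_ + _); rewrite big_distrr; apply: eq_bigr => k _ /=.
by rewrite subn1 -{1}(@prednK (n - k)) ?subn_gt0 // exprS; ring.
Qed.

Theorem theorem1p1 (n : nat) (hn : (1 <= n)%N) :
  tofrac (eulerianB n) =
    tofrac (Ppoly n) + (tofrac 'X) ^+ n * subst (Ppoly n) (tofrac 'X)^-1.
Proof.
rewrite -[subst _ _]/(invX_eval (Ppoly n)) Ppoly_reciprocal -tofracD.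
congr tofrac; have /(_ hn) := binomial_transform_sym n.
rewrite !binomial_transform_top -/(Ppoly n) => E.
have X1 : 'X - 1 != 0 :> {poly int} by rewrite -polyC1 polyXsubC_eq0.
apply: (mulfI X1); apply/esym/eqP; rewrite -subr_eq0 /=.
set Q := \sum_(_ < _) _ in E *.
(* After multiplication by the nonzero X-1, the difference of the two sides is S_(-1)(n) - X
   S_1(n). *)
have -> : ('X - 1) * (Ppoly n + 'X * Q) - ('X - 1) * eulerianB n =
    eulerianB n + ('X - 1) * Ppoly n - 'X * (eulerianB n + (1 - 'X) * Q).
  by ring.
by rewrite E subrr.
Qed.
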